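(* For all $e, f \in \mathbb{E}$: \[ e \equiv f \iff (\forall M)\big([\![ e ]\!]_M = [\![ f ]\!]_M\big). \]
   Context: Fix countably infinite disjoint alphabets $\Sigma$ (atomic actions) and $\Pi$ (atomic propositions). The set $\mathbb{E}$ of expressions is given by $e,f ::= \mathtt{a}\in\Sigma \mid \mathtt{p}\in\Pi \mid \mathtt{0} \mid \mathtt{1} \mid e+f \mid e\cdot f \mid e^{\bot} \mid e^{\top} \mid e^{*}$ ($^{\bot}$ antidomain, $^{\top}$ domain). $\equiv$ is the smallest congruence on $\mathbb{E}$ satisfying the Kleene algebra axioms (idempotent semiring laws, $\mathtt{1}+e\cdot e^{*}\leqq e^{*}$, $\mathtt{1}+e^{*}\cdot e\leqq e^{*}$, $f+e\cdot g\leqq g \Rightarrow e^{*}\cdot f\leqq g$, $f+g\cdot e\leqq g\Rightarrow f\cdot e^{*}\leqq g$) together with $e^{\bot}\cdot e\equiv\mathtt{0}$, $(e\cdot f)^{\bot}\equiv(e\cdot f^{\top})^{\bot}$, $e^{\bot}+e^{\top}\equiv\mathtt{1}$, $\mathtt{p}^{\top}\equiv\mathtt{p}$ ($\mathtt{p}\in\Pi$), $e^{\top}\equiv e^{\bot\bot}$; $e\leqq f$ means $e+f\equiv f$. $M$ ranges over relational models $M=\langle X,\mathsf{rel}_M,\mathsf{sat}_M\rangle$ with $\mathsf{rel}_M:\Sigma\to 2^{X\times X}$, $\mathsf{sat}_M:\Pi\to 2^X$. The interpretation $[\![ - ]\!]_M:\mathbb{E}\to 2^{X\times X}$ is: $[\![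 \mathtt{a} ]\!]_M=\mathsf{rel}_M(\mathtt{a})$, $[\![ \mathtt{p} ]\!]_M$ = identity relation on $\mathsf{sat}_M(\mathtt{p})$, $[\![ \mathtt{0} ]\!]_M=\emptyset$, $[\![ \mathtt{1} ]\!]_M=1_X$, $+$ as union, $\cdot$ as relational composition, $^{*}$ as reflexive transitive closure, $[\![ e^{\bot} ]\!]_M=\{\langle x,x\rangle\mid \neg\exists y\,\langle x,y\rangle\in[\![ e ]\!]_M\}$, $[\![ e^{\top} ]\!]_M=\{\langle x,x\rangle\mid \exists y\,\langle x,y\rangle\in[\![ e ]\!]_M\}$. *)

(* Defs.v *)
From Stdlib Require Import Relations FinFun.

Definition countably_infinite (A : Type) : Prop :=
  exists f : nat -> A, Bijective f.

(** The alphabets [Sigma] (atomic actions) and [Pi] (atomic propositions) are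
    embedded by distinct constructors, so they are disjoint as sets of atoms. *)
Inductive expr (Sigma Pi : Type) : Type :=
| Act (a : Sigma)
| Prp (p : Pi)
| Zero
| One
| Plus (e f : expr Sigma Pi)
| Seq (e f : expr Sigma Pi)
| Anti (e : expr Sigma Pi)
| Dom (e : expr Sigma Pi)
| Star (e : expr Sigma Pi).

Arguments Act {Sigma Pi} a.
Arguments Prp {Sigma Pi} p.
Arguments Zero {Sigma Pi}.
Arguments One {Sigma Pi}.
Arguments Plus {Sigma Pi} e f.
Arguments Seq {Sigma Pi} e f.
Arguments Anti {Sigma Pi} e.
Arguments Dom {Sigma Pi} e.
Arguments Star {Sigma Pi} e.

Declare Scope expr_scope.
Delimit Scope expr_scope with expr.
Bind Scope expr_scope with expr.

Notation "0" := Zero : expr_scope.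
Notation "1" := One : expr_scope.
Notation "e + f" := (Plus e f) : expr_scope.
Notation "e * f" := (Seq e f) : expr_scope.
Notation "e ^⊥" := (Anti e) (at level 1, left associativity, format "e ^⊥")
  : expr_scope.
Notation "e ^⊤" := (Dom e) (at level 1, left associativity, format "e ^⊤")
  : expr_scope.
Notation "e ^*" := (Star e) (at level 1, left associativity, format "e ^*")
  : expr_scope.

Reserved Notation "e ≡ f" (at level 70, no associativity).
Reserved Notation "e ≦ f" (at level 70, no associativity).

Inductive kad_equiv {Sigma Pi : Type} : expr Sigma Pi -> expr Sigma Pi -> Prop :=
| equiv_refl e : e ≡ e
| equiv_sym e f : e ≡ f -> f ≡ e
| equiv_trans e f g : e ≡ f -> f ≡ g -> e ≡ g
| equiv_plus e e' f f' : e ≡ e' -> f ≡ f' -> e + f ≡ e' + f'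
| equiv_seq e e' f f' : e ≡ e' -> f ≡ f' -> e * f ≡ e' * f'
| equiv_anti e e' : e ≡ e' -> e^⊥ ≡ e'^⊥
| equiv_dom e e' : e ≡ e' -> e^⊤ ≡ e'^⊤
| equiv_star e e' : e ≡ e' -> e^* ≡ e'^*
| plus_assoc e f g : e + (f + g) ≡ (e + f) + g
| plus_comm e f : e + f ≡ f + e
| plus_zero e : e + 0 ≡ e
| plus_idem e : e + e ≡ e
| seq_assoc e f g : e * (f * g) ≡ (e * f) * g
| one_seq e : 1 * e ≡ e
| seq_one e : e * 1 ≡ e
| zero_seq e : 0 * e ≡ 0
| seq_zero e : e * 0 ≡ 0
| seq_plus e f g : e * (f + g) ≡ e * f + e * g
| plus_seq e f g : (e + f) * g ≡ e * g + f * g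
| star_unfold_l e : 1 + e * e^* ≦ e^*
| star_unfold_r e : 1 + e^* * e ≦ e^*
| star_ind_l e f g : f + e * g ≦ g -> e^* * f ≦ g
| star_ind_r e f g : f + g * e ≦ g -> f * e^* ≦ g
| anti_seq e : e^⊥ * e ≡ 0
| anti_local e f : (e * f)^⊥ ≡ (e * f^⊤)^⊥
| anti_compl e : e^⊥ + e^⊤ ≡ 1
| dom_prp p : (Prp p)^⊤ ≡ Prp p
| dom_anti e : e^⊤ ≡ e^⊥^⊥
where "e ≡ f" := (kad_equiv e%expr f%expr) : type_scope
and "e ≦ f" := (kad_equiv (e + f)%expr f%expr) : type_scope.

Record model (Sigma Pi : Type) : Type := Model {
  carrier : Type;
  rel : Sigma -> relation carrier;
  sat : Pi -> carrier -> Prop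
}.

Arguments carrier {Sigma Pi} M : rename.
Arguments rel {Sigma Pi} M a _ _ : rename.
Arguments sat {Sigma Pi} M p _ : rename.

Fixpoint interp {Sigma Pi : Type} (M : model Sigma Pi) (e : expr Sigma Pi)
  : relation (carrier M) :=
  match e with
  | Act a => rel M a
  | Prp p => fun x y => x = y /\ sat M p x
  | Zero => fun _ _ => False
  | One => fun x y => x = y
  | Plus e f => union _ (interp M e) (interp M f)
  | Seq e f => fun x z => exists y, interp M e x y /\ interp M f y z
  | Anti e => fun x y => x = y /\ ~ exists z, interp M e x z
  | Dom e => fun x y => x = y /\ exists z, interp M e x z
  | Star e => clos_refl_trans _ (interp M e)
  end.

(* Main.v *)
(** For completeness it suffices to derive [e ≦ f] from the inclusion of
    [e] in [f] in one finite model. Let [X] be a Fischer-Ladner closure of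
    [e] and [f]. The states are pairs of a consistent atom (a choice of [x^⊤] or
    [x^⊥] for every [x] in [X]) and a set of expressions of [X]; the latter
    evolves deterministically as the largest set whose sum [goal t] satisfies
    [α * a * β * goal t ≦ goal s].

    As the model is finite, Kleene's construction gives expressions [conn s t]
    for its paths, with [conn s t * goal t ≦ goal s]. By induction on [h], [α * h]
    lies below the sum of [conn s t] over all [t] to which [h] leads from
    [s = (α, S)]; the star case only needs [conn s k * conn k t ≦ conn s t] and
    right induction. Started with [goal s ≦ f], every [t] to which [f] leads from
    [s] satisfies [β ≦ goal t], hence [conn s t ≦ conn s t * β ≦ goal s ≦ f]. If
    [e] leads only where [f] leads, these bounds sum up to [e ≦ f]. *)

Require Import Defs.
From Stdlib Require Import Relations.
From Stdlib Require Import List Morphisms Setoid Classical ClassicalEpsilon.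
Import ListNotations.

(** * The derived order and its rewriting instances *)

Local Open Scope expr_scope.

(** The notation [≦] unfolds to an equivalence; a named relation can carry instances for
    rewriting. *)
Definition kad_le {Sigma Pi : Type} (e f : expr Sigma Pi) : Prop := e ≦ f.

Local Infix "⊑" := kad_le (at level 70, no associativity).

Global Instance kad_equiv_Equivalence {Sigma Pi : Type} :
  Equivalence (@kad_equiv Sigma Pi).
Proof.
  split; [exact Defs.equiv_refl | exact Defs.equiv_sym | exact Defs.equiv_trans].
Qed.

Global Instance Plus_equiv {Sigma Pi : Type} :
  Proper (kad_equiv ==> kad_equiv ==> kad_equiv) (@Plus Sigma Pi).
Proof. intros x x' Hx y y' Hy; apply equiv_plus; assumption. Qed.

Global Instance Seq_equiv {Sigma Pi : Type} :
  Proper (kad_equiv ==> kad_equiv ==> kad_equiv) (@Seq Sigma Pi).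
Proof. intros x x' Hx y y' Hy; apply equiv_seq; assumption. Qed.

Global Instance Anti_equiv {Sigma Pi : Type} :
  Proper (kad_equiv ==> kad_equiv) (@Anti Sigma Pi).
Proof. intros x x' Hx; apply equiv_anti; assumption. Qed.

Global Instance Dom_equiv {Sigma Pi : Type} :
  Proper (kad_equiv ==> kad_equiv) (@Dom Sigma Pi).
Proof. intros x x' Hx; apply equiv_dom; assumption. Qed.

Global Instance kad_le_equiv {Sigma Pi : Type} :
  Proper (kad_equiv ==> kad_equiv ==> iff) (@kad_le Sigma Pi).
Proof.
  intros x x' Hx y y' Hy; unfold kad_le; rewrite Hx, Hy; reflexivity.
Qed.

Global Instance kad_le_PreOrder {Sigma Pi : Type} :
  PreOrder (@kad_le Sigma Pi).
Proof.
  split.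
  - intros x; apply plus_idem.
  - intros x y z Hxy Hyz; unfold kad_le in *.
    rewrite <- Hyz, plus_assoc, Hxy; reflexivity.
Qed.

Global Instance Plus_le {Sigma Pi : Type} :
  Proper (kad_le ==> kad_le ==> kad_le) (@Plus Sigma Pi).
Proof.
  intros x x' Hx y y' Hy; unfold kad_le in *.
  rewrite <- plus_assoc, (plus_assoc y), (plus_comm y), <- plus_assoc, Hy.
  rewrite plus_assoc, Hx; reflexivity.
Qed.

Global Instance Seq_le {Sigma Pi : Type} :
  Proper (kad_le ==> kad_le ==> kad_le) (@Seq Sigma Pi).
Proof.
  intros x x' Hx y y' Hy; transitivity (x' * y); unfold kad_le in *.
  - rewrite <- plus_seq, Hx; reflexivity.
  - rewrite <- seq_plus, Hy; reflexivity.
Qed.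

(** * Star, antidomain and tests *)

Section Algebra.
Context {Sigma Pi : Type}.
Implicit Types (e f g h x y z p q : expr Sigma Pi).

Lemma equiv_le e f : e ≡ f -> e ⊑ f.
Proof. intros H; rewrite H; reflexivity. Qed.

Lemma le_antisym e f : e ⊑ f -> f ⊑ e -> e ≡ f.
Proof.
  unfold kad_le; intros H1 H2; rewrite <- H1, plus_comm; symmetry; exact H2.
Qed.

Lemma zero_le e : 0 ⊑ e.
Proof. unfold kad_le; rewrite plus_comm; apply plus_zero. Qed.

Lemma le_zero e : e ⊑ 0 -> e ≡ 0.
Proof. unfold kad_le; rewrite plus_zero; trivial. Qed.

Lemma le_plus_l e f : e ⊑ e + f.
Proof. unfold kad_le; rewrite plus_assoc, plus_idem; reflexivity. Qed.

Lemma le_plus_r e f : f ⊑ e + f.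
Proof. rewrite plus_comm; apply le_plus_l. Qed.

Lemma plus_lub e f g : e ⊑ g -> f ⊑ g -> e + f ⊑ g.
Proof. intros He Hf; rewrite He, Hf; apply equiv_le, plus_idem. Qed.

Lemma star_ge_one e : 1 ⊑ e^*.
Proof. transitivity (1 + e * e^*); [apply le_plus_l | apply star_unfold_l]. Qed.

Lemma star_step_l e : e * e^* ⊑ e^*.
Proof. transitivity (1 + e * e^*); [apply le_plus_r | apply star_unfold_l]. Qed.

Lemma star_step_r e : e^* * e ⊑ e^*.
Proof. transitivity (1 + e^* * e); [apply le_plus_r | apply star_unfold_r]. Qed.

Lemma star_least_l e f g : f ⊑ g -> e * g ⊑ g -> e^* * f ⊑ g.
Proof. intros H1 H2; apply star_ind_l, plus_lub; assumption. Qed.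

Lemma star_least_r e f g : f ⊑ g -> g * e ⊑ g -> f * e^* ⊑ g.
Proof. intros H1 H2; apply star_ind_r, plus_lub; assumption. Qed.

Lemma star_star e : e^* * e^* ⊑ e^*.
Proof. apply star_least_l; [reflexivity | apply star_step_l]. Qed.

Lemma anti_one : (1 : expr Sigma Pi)^⊥ ≡ 0.
Proof. rewrite <- (anti_seq 1), seq_one; reflexivity. Qed.

Lemma anti_zero : (0 : expr Sigma Pi)^⊥ ≡ 1.
Proof.
  transitivity ((1 : expr Sigma Pi)^⊤).
  - rewrite dom_anti, anti_one; reflexivity.
  - rewrite <- (plus_zero (1^⊤)), plus_comm, <- anti_one; apply anti_compl.
Qed.

Lemma anti_eq_one e : e^⊥ ≡ 1 -> e ≡ 0.
Proof. intros H; rewrite <- (one_seq e), <- H; apply anti_seq. Qed.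

(** Locality gives both products the same antidomain, and an expression vanishes exactly when its
    antidomain is [1]. *)
Lemma seq_dom_zero e f : e * f^⊤ ≡ 0 <-> e * f ≡ 0.
Proof.
  split; intros H; apply anti_eq_one.
  - rewrite anti_local, H; apply anti_zero.
  - rewrite <- anti_local, H; apply anti_zero.
Qed.

(** Stated in the semiring alone; both orders of the product are listed because [Seq] does not
    commute. *)
Definition complementary p q : Prop := p + q ≡ 1 /\ p * q ≡ 0 /\ q * p ≡ 0.

Definition is_test p : Prop := exists q, complementary p q.

Lemma complementary_sym p q : complementary p q -> complementary q p.
Proof.
  intros (H1 & H2 & H3); split; [rewrite plus_comm | split]; assumption.
Qed.

Lemma anti_dom_complementary e : complementary e^⊥ e^⊤.
Proof.
  split; [apply anti_compl | split].
  - apply seq_dom_zero, anti_seq.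
  - rewrite dom_anti; apply anti_seq.
Qed.

Lemma test_anti e : is_test e^⊥.
Proof. exists (e^⊤); apply anti_dom_complementary. Qed.

Lemma test_dom e : is_test e^⊤.
Proof. exists (e^⊥); apply complementary_sym, anti_dom_complementary. Qed.

Lemma test_one : is_test 1.
Proof.
  exists 0; split; [apply plus_zero | split; [apply seq_zero | apply zero_seq]].
Qed.

Lemma complementary_le_one p q : complementary p q -> p ⊑ 1.
Proof. intros (H & _); rewrite <- H; apply le_plus_l. Qed.

Lemma test_le_one p : is_test p -> p ⊑ 1.
Proof. intros (q & H); exact (complementary_le_one _ _ H). Qed.

Lemma test_seq_le p e : is_test p -> p * e ⊑ e.
Proof. intros H; rewrite (test_le_one _ H), one_seq; reflexivity. Qed.

Lemma seq_test_le p e : is_test p -> e * p ⊑ e.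
Proof. intros H; rewrite (test_le_one _ H), seq_one; reflexivity. Qed.

Lemma test_idem p : is_test p -> p * p ≡ p.
Proof.
  intros (q & H1 & H2 & _).
  rewrite <- (seq_one p) at 3; rewrite <- H1, seq_plus, H2, plus_zero.
  reflexivity.
Qed.

Lemma test_seq p q : is_test p -> is_test q -> is_test (p * q).
Proof.
  intros Hp Hq; pose proof Hp as (p' & P1 & P2 & P3).
  pose proof Hq as (q' & Q1 & Q2 & Q3).
  (* The complement is chosen so that the total regroups as [p * (q + q') + p']. *)
  exists (p' + p * q'); split; [| split].
  - rewrite (plus_comm p'), plus_assoc, <- seq_plus, Q1, seq_one; exact P1.
  - rewrite seq_plus; apply le_zero, plus_lub.
    + rewrite (seq_test_le q p Hq), P2; reflexivity.
    + rewrite (test_seq_le p q Hp), (test_seq_le p q' Hp), Q2; reflexivity.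
  - rewrite plus_seq; apply le_zero, plus_lub.
    + rewrite (seq_test_le q p Hq), P3; reflexivity.
    + rewrite (test_seq_le p q Hp), (test_seq_le p q' Hp), Q3; reflexivity.
Qed.

Lemma anti_absorb x g : x * g ≡ 0 -> x * g^⊥ ≡ x.
Proof.
  intros H; apply seq_dom_zero in H.
  rewrite <- (seq_one x) at 2.
  rewrite <- (anti_compl g), seq_plus, H, plus_zero; reflexivity.
Qed.

Lemma dom_absorb x g : x * g^⊥ ≡ 0 -> x * g^⊤ ≡ x.
Proof.
  intros H; rewrite <- (seq_one x) at 2.
  rewrite <- (anti_compl g), seq_plus, H, plus_comm, plus_zero; reflexivity.
Qed.

End Algebra.

(** * Finite sums and classically selected sublists *)

Section Sums.
Context {Sigma Pi : Type} {T : Type}.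
Implicit Types (F : T -> expr Sigma Pi) (l : list T).

Definition sum F l : expr Sigma Pi := fold_right (fun t s => F t + s) 0 l.

Lemma sum_ub F l t : In t l -> F t ⊑ sum F l.
Proof.
  induction l as [|u l IH]; simpl; [tauto | intros [-> | H]].
  - apply le_plus_l.
  - rewrite (IH H); apply le_plus_r.
Qed.

Lemma sum_lub F l z : (forall t, In t l -> F t ⊑ z) -> sum F l ⊑ z.
Proof.
  induction l as [|u l IH]; simpl; intros H; [apply zero_le |].
  apply plus_lub; [| apply IH]; auto.
Qed.

Lemma sum_seq F l g : sum F l * g ≡ sum (fun t => F t * g) l.
Proof.
  induction l as [|u l IH]; simpl; [apply zero_seq |].
  rewrite plus_seq, IH; reflexivity.
Qed.

Lemma seq_sum F l g : g * sum F l ≡ sum (fun t => g * F t) l.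
Proof.
  induction l as [|u l IH]; simpl; [apply seq_zero |].
  rewrite seq_plus, IH; reflexivity.
Qed.

Definition select (P : T -> Prop) l : list T :=
  filter (fun t => if excluded_middle_informative (P t) then true else false) l.

Lemma in_select (P : T -> Prop) l t : In t (select P l) <-> In t l /\ P t.
Proof.
  unfold select; rewrite filter_In.
  destruct (excluded_middle_informative (P t)); intuition discriminate.
Qed.

Fixpoint sublists l : list (list T) :=
  match l with
  | [] => [[]]
  | t :: l => sublists l ++ map (cons t) (sublists l)
  end.

(** Lets a set of residuals be defined by an arbitrary predicate and still be one of finitely many
    candidates. *)
Lemma select_sublist (P : T -> Prop) l : In (select P l) (sublists l).
Proof.
  induction l as [|t l IH]; [left; reflexivity |].
  unfold select in *; simpl; apply in_or_app.
  destruct (excluded_middle_informative (P t)); [right | left; exact IH].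
  apply in_map; exact IH.
Qed.

End Sums.

(** * Path expressions of a finite graph *)

Section Paths.
Context {Sigma Pi : Type} {T : Type}.
Context (B : T -> T -> expr Sigma Pi).

(** Kleene's construction: the paths from [s] to [t] along edges [B] all of
    whose intermediate states belong to [l]. *)
Fixpoint paths (l : list T) (s t : T) : expr Sigma Pi :=
  match l with
  | [] => B s t
  | k :: l => paths l s t + paths l s k * ((paths l k k)^* * paths l k t)
  end.

Lemma paths_edge l s t : B s t ⊑ paths l s t.
Proof.
  induction l as [|k l IH]; simpl; [reflexivity |].
  rewrite IH; apply le_plus_l.
Qed.

Lemma paths_seq l s k t :
  In k l -> paths l s k * paths l k t ⊑ paths l s t.
Proof.
  revert s k t; induction l as [|j l IH]; simpl; [tauto |].
  intros s k t [-> | Hk].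
  - etransitivity; [| apply le_plus_r].
    set (a := paths l k k).
    assert (H1 : paths l s k + paths l s k * (a^* * a) ⊑ paths l s k * a^*).
    { apply plus_lub; [| rewrite star_step_r; reflexivity].
      rewrite <- star_ge_one, seq_one; reflexivity. }
    assert (H2 : paths l k t + a * (a^* * paths l k t) ⊑ a^* * paths l k t).
    { apply plus_lub.
      - rewrite <- star_ge_one, one_seq; reflexivity.
      - rewrite seq_assoc, star_step_l; reflexivity. }
    rewrite H1, H2, <- seq_assoc, (seq_assoc (a^*)), star_star; reflexivity.
  - rewrite seq_plus, !plus_seq.
    set (a := paths l j j).
    repeat apply plus_lub.
    + rewrite IH by assumption; apply le_plus_l.
    + etransitivity; [| apply le_plus_r].
      rewrite <- !seq_assoc, IH by assumption; reflexivity.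
    + etransitivity; [| apply le_plus_r].
      rewrite seq_assoc, IH by assumption; reflexivity.
    + etransitivity; [| apply le_plus_r].
      rewrite <- !seq_assoc.
      (* The stretch from [j] through [k] back to [j] is itself a loop at [j], absorbed between the
         two stars. *)
      rewrite (seq_assoc (paths l j k)), (IH j k j) by assumption.
      fold a; rewrite (seq_assoc a), star_step_l, (seq_assoc (a^*)), star_star.
      reflexivity.
Qed.

(** For an excursion through [k], the loops at [k] preserve [F k], so left star induction
    applies. *)
Lemma paths_invariant (F : T -> expr Sigma Pi) l :
  (forall s t, B s t * F t ⊑ F s) ->
  forall s t, paths l s t * F t ⊑ F s.
Proof.
  intros HB; induction l as [|k l IH]; simpl; [exact HB | intros s t].
  rewrite plus_seq; apply plus_lub; [apply IH |].
  rewrite <- !seq_assoc, (IH k t), (star_least_l _ _ (F k)); auto.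
  reflexivity.
Qed.

Lemma paths_guard l t g :
  (forall s, B s t ⊑ B s t * g) -> forall s, paths l s t ⊑ paths l s t * g.
Proof.
  intros HB; induction l as [|k l IH]; simpl; [exact HB | intros s].
  rewrite plus_seq, <- !seq_assoc, <- !IH; reflexivity.
Qed.

End Paths.

(** * Atoms over a finite set of expressions *)

Section Atoms.
Context {Sigma Pi : Type}.
Implicit Types (X : list (expr Sigma Pi)) (x a : expr Sigma Pi).

Fixpoint atoms X : list (expr Sigma Pi) :=
  match X with
  | [] => [1]
  | x :: X => map (Seq x^⊤) (atoms X) ++ map (Seq x^⊥) (atoms X)
  end.

Lemma in_atoms_cons x X a :
  In a (atoms (x :: X)) ->
  exists b, In b (atoms X) /\ (a = x^⊤ * b \/ a = x^⊥ * b).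
Proof.
  simpl; rewrite in_app_iff, !in_map_iff.
  intros [(b & <- & H) | (b & <- & H)]; exists b; auto.
Qed.

Lemma atom_test X a : In a (atoms X) -> is_test a.
Proof.
  revert a; induction X as [|x X IH]; intros a H.
  - destruct H as [<- | []]; apply test_one.
  - apply in_atoms_cons in H as (b & Hb & [-> | ->]);
      apply test_seq; auto using test_dom, test_anti.
Qed.

Lemma atom_decides X a x : In a (atoms X) -> In x X -> a * x ≡ 0 \/ a * x^⊥ ≡ 0.
Proof.
  revert a; induction X as [|y X IH]; intros a Ha Hx; [destruct Hx |].
  apply in_atoms_cons in Ha as (b & Hb & Ha).
  destruct Hx as [-> | Hx].
  - pose proof (atom_test X b Hb) as Tb.
    destruct (anti_dom_complementary x) as (_ & H1 & H2).
    destruct Ha as [-> | ->]; [right | left; apply seq_dom_zero];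
      apply le_zero; rewrite (seq_test_le b _ Tb);
      apply equiv_le; assumption.
  - destruct (IH b Hb Hx) as [H | H]; [left | right];
      destruct Ha as [-> | ->]; rewrite <- seq_assoc, H; apply seq_zero.
Qed.

Lemma one_le_atoms X : 1 ⊑ sum (fun a => a) (atoms X).
Proof.
  induction X as [|x X IH].
  - simpl; apply le_plus_l.
  - transitivity ((x^⊥ + x^⊤) * sum (fun a => a) (atoms X)).
    { rewrite anti_compl, one_seq; exact IH. }
    rewrite seq_sum; apply sum_lub; intros a Ha.
    rewrite plus_seq; apply plus_lub;
      apply (sum_ub (fun a => a)); simpl; apply in_or_app;
      [right | left]; apply in_map; assumption.
Qed.

End Atoms.

(** * The canonical model *)

Section Canonical.
Context {Sigma Pi : Type}.
Implicit Types (X : list (expr Sigma Pi)) (c g h x : expr Sigma Pi).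

(** Fischer-Ladner closure of [h] run before a continuation [c]: it contains
    every residual expression that remains after a partial run of [h * c]. *)
Fixpoint closure (h c : expr Sigma Pi) : list (expr Sigma Pi) :=
  h * c :: c ::
  match h with
  | Act _ | Prp _ => [h]
  | 0 | 1 => []
  | g1 + g2 => closure g1 c ++ closure g2 c
  | g1 * g2 => closure g1 (g2 * c) ++ closure g2 c
  | g^⊥ | g^⊤ => closure g 1
  | g^* => closure g (g^* * c)
  end.

(** The second component of a state is a set of residuals whose sum [goal]
    plays the role of a state of a deterministic automaton for [f]. *)
Definition state : Type := expr Sigma Pi * list (expr Sigma Pi).

Definition goal (s : state) : expr Sigma Pi := sum (fun x => x) (snd s).

Definition states X : list state :=
  select (fun s => ~ fst s ≡ 0) (list_prod (atoms X) (sublists X)).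

(** The last two clauses of [rel] bound [goal t] from above and from below, which determines
    [fst t * goal t] up to equivalence as the maximal choice. *)
Definition canonical X : model Sigma Pi := {|
  carrier := state;
  rel a s t :=
    In s (states X) /\ In t (states X) /\
    ~ fst s * Act a * fst t ≡ 0 /\
    fst s * Act a * fst t * goal t ⊑ goal s /\
    (forall x, In x X -> fst s * Act a * fst t * x ⊑ goal s ->
       fst t * x ⊑ goal t);
  sat p s := ~ fst s * Prp p ≡ 0
|}.

(** Labels range over all of [X]: [1] provides the trivial path in [conn_refl], and actions provide
    the steps of the model. *)
Definition edge X (s t : state) : expr Sigma Pi :=
  sum (fun b => fst s * b * fst t)
    (select (fun b => fst s * b * fst t * goal t ⊑ goal s) X).

Definition conn X : state -> state -> expr Sigma Pi :=
  paths (edge X) (states X).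

Definition reach X (h : expr Sigma Pi) (s : state) : expr Sigma Pi :=
  sum (conn X s) (select (interp (canonical X) h s) (states X)).

Lemma in_states X s :
  In s (states X) <->
  In (fst s) (atoms X) /\ In (snd s) (sublists X) /\ ~ fst s ≡ 0.
Proof.
  unfold states, state; rewrite in_select; destruct s as [a S].
  rewrite in_prod_iff; simpl; tauto.
Qed.

Lemma state_test X s : In s (states X) -> is_test (fst s).
Proof. rewrite in_states; intros (H & _); exact (atom_test _ _ H). Qed.

Lemma state_nonzero X s : In s (states X) -> ~ fst s ≡ 0.
Proof. rewrite in_states; tauto. Qed.

Lemma state_decides X s x :
  In s (states X) -> In x X -> fst s * x ≡ 0 \/ fst s * x^⊥ ≡ 0.
Proof.
  rewrite in_states; intros (H & _) Hx; exact (atom_decides _ _ _ H Hx).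
Qed.

Lemma state_dom X s x :
  In s (states X) -> In x X -> ~ fst s * x ≡ 0 -> fst s * x^⊤ ≡ fst s.
Proof.
  intros Hs Hx H; apply dom_absorb.
  destruct (state_decides X s x Hs Hx); [contradiction | assumption].
Qed.

Lemma conn_seq X s k t :
  In k (states X) -> conn X s k * conn X k t ⊑ conn X s t.
Proof. apply paths_seq. Qed.

Lemma conn_goal X s t : conn X s t * goal t ⊑ goal s.
Proof.
  apply paths_invariant; clear s t; intros s t.
  unfold edge; rewrite sum_seq; apply sum_lub; intros b Hb.
  apply in_select in Hb; tauto.
Qed.

Lemma in_canonical X h s t :
  In s (states X) -> interp (canonical X) h s t -> In t (states X).
Proof.
  revert s t; induction h; simpl; intros s t Hs H; try tauto.
  - destruct H as (<- & _); exact Hs.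
  - subst; exact Hs.
  - destruct H as [H | H]; eauto.
  - destruct H as (m & H1 & H2); eauto.
  - destruct H as (<- & _); exact Hs.
  - destruct H as (<- & _); exact Hs.
  - induction H; eauto.
Qed.

Lemma conn_guard X s t :
  In t (states X) -> conn X s t ⊑ conn X s t * fst t.
Proof.
  intros Ht; apply paths_guard; clear s; intros s.
  unfold edge; rewrite sum_seq; apply sum_lub; intros b Hb.
  etransitivity; [| exact (sum_ub (fun b => fst s * b * fst t * fst t) _ b Hb)].
  rewrite <- !seq_assoc, (test_idem (fst t) (state_test X t Ht)); reflexivity.
Qed.

Lemma edge_conn X s t b :
  In b X -> fst s * b * fst t * goal t ⊑ goal s ->
  fst s * b * fst t ⊑ conn X s t.
Proof.
  intros Hb H; unfold conn; rewrite <- paths_edge.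
  apply (sum_ub (fun b => fst s * b * fst t)), in_select; auto.
Qed.

Lemma conn_refl X s : In 1 X -> In s (states X) -> fst s ⊑ conn X s s.
Proof.
  intros H1 Hs; pose proof (state_test X s Hs) as Ts.
  assert (E : fst s * 1 * fst s ≡ fst s) by (rewrite seq_one; apply test_idem, Ts).
  rewrite <- E; apply edge_conn; [exact H1 |].
  rewrite E; apply test_seq_le, Ts.
Qed.

Lemma conn_reach X h s t :
  In t (states X) -> interp (canonical X) h s t -> conn X s t ⊑ reach X h s.
Proof. intros Ht H; apply sum_ub, in_select; auto. Qed.

Lemma reach_lub X h s z :
  (forall t, In t (states X) -> interp (canonical X) h s t -> conn X s t ⊑ z) ->
  reach X h s ⊑ z.
Proof. intros H; apply sum_lub; intros t Ht; apply in_select in Ht; firstorder. Qed.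

Lemma reach_seq_lub X h s g z :
  (forall t, In t (states X) -> interp (canonical X) h s t ->
     conn X s t * g ⊑ z) ->
  reach X h s * g ⊑ z.
Proof.
  intros H; unfold reach; rewrite sum_seq.
  apply sum_lub; intros t Ht; apply in_select in Ht; firstorder.
Qed.

Lemma reach_empty X h s :
  ~ (exists t, interp (canonical X) h s t) -> reach X h s ≡ 0.
Proof. intros H; apply le_zero, reach_lub; intros t _ Ht; destruct H; eauto. Qed.

(** [covered], [consistent] and [tracked] need a joint induction on [h]: each
    antidomain or domain subexpression has to be decided in the same way by the
    model and by the atoms, which takes [covered] in one direction and
    [consistent] in the other. *)
Definition covered X h : Prop :=
  forall s, In s (states X) -> fst s * h ⊑ reach X h s.

Definition consistent X h c : Prop :=
  forall s t, In s (states X) -> interp (canonical X) h s t ->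
    ~ fst t * c ≡ 0 -> ~ fst s * (h * c) ≡ 0.

Definition tracked X h c : Prop :=
  forall s t, In s (states X) -> interp (canonical X) h s t ->
    fst s * (h * c) ⊑ goal s -> fst t * c ⊑ goal t.

(** Shared by the constructors interpreted inside the identity: propositions, [0], [1], antidomain
    and domain. Each atom either absorbs such an [h] or annihilates it. *)
Lemma test_facts X h c :
  In 1 X ->
  (forall s, In s (states X) ->
     (forall t, interp (canonical X) h s t -> s = t /\ fst s * h ≡ fst s) /\
     (interp (canonical X) h s s \/ fst s * h ≡ 0)) ->
  covered X h /\ consistent X h c /\ tracked X h c.
Proof.
  intros H1 H; split; [| split].
  - intros s Hs; destruct (H s Hs) as (Ht & [Hi | H0]).
    + destruct (Ht s Hi) as (_ & ->).
      rewrite (conn_refl X s H1 Hs); apply conn_reach; assumption.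
    + rewrite H0; apply zero_le.
  - intros s t Hs Hi; destruct (H s Hs) as (Ht & _).
    destruct (Ht t Hi) as (<- & E); rewrite seq_assoc, E; trivial.
  - intros s t Hs Hi; destruct (H s Hs) as (Ht & _).
    destruct (Ht t Hi) as (<- & E); rewrite seq_assoc, E; trivial.
Qed.

Lemma act_facts X a c :
  In (Act a) X -> In c X ->
  covered X (Act a) /\ consistent X (Act a) c /\ tracked X (Act a) c.
Proof.
  intros Ha Hc; split; [| split].
  - intros s Hs.
    rewrite <- (seq_one (fst s * Act a)), (one_le_atoms X), seq_sum.
    apply sum_lub; intros b Hb.
    destruct (classic (fst s * Act a * b ≡ 0)) as [-> | Hn]; [apply zero_le |].
    set (P := fun x => fst s * Act a * b * x ⊑ goal s).
    (* Taking every admissible residual makes [goal t] maximal, as [rel] demands. *)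
    set (t := (b, select P X)).
    assert (Tb : is_test b) by exact (atom_test _ _ Hb).
    assert (Hg : fst s * Act a * fst t * goal t ⊑ goal s).
    { unfold goal at 1; rewrite seq_sum; apply sum_lub; intros x Hx.
      apply in_select in Hx; apply Hx. }
    assert (Ht : In t (states X)).
    { apply in_states; split; [exact Hb | split; [apply select_sublist |]].
      simpl; intros H0; apply Hn; rewrite H0; apply seq_zero. }
    change b with (fst t); rewrite (edge_conn X s t (Act a) Ha Hg).
    apply conn_reach; [exact Ht |].
    repeat split; try assumption.
    intros x Hx Hle; simpl; rewrite (test_seq_le b x Tb).
    apply (sum_ub (fun x => x)), in_select; auto.
  - intros s t _ (Hs & Ht & Hn & _) Htc H0; apply Hn.
    (* As [fst t] meets [c], it absorbs [c^⊤]; locality carries the assumed zero from [c] over to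
       [c^⊤]. *)
    rewrite <- (state_dom X t c Ht Hc Htc).
    rewrite seq_assoc in H0; apply seq_dom_zero in H0; apply le_zero.
    rewrite seq_assoc, (seq_test_le (fst t) _ (state_test X t Ht)), H0.
    reflexivity.
  - intros s t _ (Hs & Ht & _ & _ & Hx) Hle; apply Hx; [exact Hc |].
    rewrite (seq_test_le (fst t) _ (state_test X t Ht)), <- seq_assoc.
    exact Hle.
Qed.

(** After each pass of the body the residual is again [g^* * c], so the last two properties follow
    by induction along the run, peeling off its first pass. *)
Lemma star_facts X g c :
  In 1 X ->
  covered X g /\ consistent X g (g^* * c) /\ tracked X g (g^* * c) ->
  covered X g^* /\ consistent X g^* c /\ tracked X g^* c.
Proof.
  intros H1 (IH1 & IH2 & IH3); split; [| split].
  - intros s Hs; apply star_least_r.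
    + rewrite (conn_refl X s H1 Hs); apply conn_reach; [exact Hs |].
      apply rt_refl.
    + apply reach_seq_lub; intros t Ht Hst.
      rewrite (conn_guard X s t Ht), <- seq_assoc, (IH1 t Ht).
      unfold reach at 1; rewrite seq_sum; apply sum_lub; intros u Hu.
      apply in_select in Hu as (Hu & Htu).
      rewrite (conn_seq X s t u Ht); apply conn_reach; [exact Hu |].
      apply rt_trans with t; [exact Hst | apply rt_step, Htu].
  - intros s t Hs Hst; apply clos_rt_rt1n in Hst; revert Hs.
    induction Hst as [s | s m t Hsm Hmt IH]; intros Hs Htc H0.
    + apply Htc, le_zero; rewrite <- H0, <- star_ge_one, one_seq; reflexivity.
    + apply (IH2 s m Hs Hsm).
      * apply IH; [exact (in_canonical X g s m Hs Hsm) | exact Htc].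
      * apply le_zero; rewrite <- H0, (seq_assoc g), star_step_l; reflexivity.
  - intros s t Hs Hst; apply clos_rt_rt1n in Hst; revert Hs.
    induction Hst as [s | s m t Hsm Hmt IH]; intros Hs Hle.
    + rewrite <- Hle, <- star_ge_one, one_seq; reflexivity.
    + apply IH; [exact (in_canonical X g s m Hs Hsm) |].
      apply (IH3 s m Hs Hsm).
      rewrite <- Hle, (seq_assoc g), star_step_l; reflexivity.
Qed.

(** A run ends in a nonzero atom, so [consistent] makes [g * 1] nonzero at [s] and the atom refutes
    [g^⊥]; without a run, [covered] bounds [fst s * g] by an empty sum. *)
Lemma run_decides X g s :
  covered X g -> consistent X g 1 -> In 1 X -> In (g * 1) X -> In s (states X) ->
  (exists t, interp (canonical X) g s t) /\
    fst s * g^⊤ ≡ fst s /\ fst s * g^⊥ ≡ 0 \/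
  ~ (exists t, interp (canonical X) g s t) /\
    fst s * g^⊤ ≡ 0 /\ fst s * g^⊥ ≡ fst s.
Proof.
  intros A B H1 Hg Hs.
  destruct (classic (exists t, interp (canonical X) g s t)) as [Hex | Hn];
    [left | right]; (split; [assumption |]).
  - destruct Hex as (t & Hst).
    assert (Hn : ~ fst s * (g * 1) ≡ 0).
    { apply (B s t Hs Hst); rewrite seq_one.
      exact (state_nonzero X t (in_canonical X g s t Hs Hst)). }
    assert (E : fst s * g^⊥ ≡ 0).
    { rewrite <- (seq_one g).
      destruct (state_decides X s _ Hs Hg); [contradiction | assumption]. }
    split; [apply dom_absorb |]; exact E.
  - assert (E : fst s * g ≡ 0).
    { apply le_zero; rewrite (A s Hs), (reach_empty X g s Hn); reflexivity. }
    split; [apply seq_dom_zero | apply anti_absorb]; exact E.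
Qed.

Lemma facts X h c :
  In 1 X -> incl (closure h c) X ->
  covered X h /\ consistent X h c /\ tracked X h c.
Proof.
  intros H1; revert c.
  induction h as [a | p | | | g1 IH1 g2 IH2 | g1 IH1 g2 IH2 | g IH | g IH | g IH];
    intros c HX; simpl in HX;
    apply incl_cons_inv in HX as (Hhc & HX);
    apply incl_cons_inv in HX as (Hc & HX).
  - apply incl_cons_inv in HX as (Ha & _); apply act_facts; assumption.
  - apply incl_cons_inv in HX as (Hp & _); apply test_facts; [exact H1 |].
    intros s Hs; split.
    + intros t (<- & Hsat); split; [reflexivity |].
      (* A proposition equals its own domain, so an atom that meets it absorbs it. *)
      rewrite <- (dom_prp p); exact (state_dom X s (Prp p) Hs Hp Hsat).
    + destruct (classic (fst s * Prp p ≡ 0)) as [H0 | H0]; [right | left];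
        [exact H0 | split; [reflexivity | exact H0]].
  - apply test_facts; [exact H1 |]; intros s Hs; split; [intros t [] |].
    right; apply seq_zero.
  - apply test_facts; [exact H1 |]; intros s Hs; split; [| left; reflexivity].
    intros t <-; split; [reflexivity | apply seq_one].
  - apply incl_app_inv in HX as (HX1 & HX2).
    destruct (IH1 c HX1) as (A1 & B1 & C1), (IH2 c HX2) as (A2 & B2 & C2).
    split; [| split].
    + intros s Hs; rewrite seq_plus, (A1 s Hs), (A2 s Hs).
      apply plus_lub; apply reach_lub; intros t Ht Hi; apply conn_reach;
        try assumption; [left | right]; exact Hi.
    + intros s t Hs [Hi | Hi] Htc H0;
        [apply (B1 s t Hs Hi Htc) | apply (B2 s t Hs Hi Htc)];
        apply le_zero; rewrite <- H0, plus_seq;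
        [rewrite <- le_plus_l | rewrite <- le_plus_r]; reflexivity.
    + intros s t Hs [Hi | Hi] Hle;
        [apply (C1 s t Hs Hi) | apply (C2 s t Hs Hi)];
        rewrite <- Hle, plus_seq;
        [rewrite <- le_plus_l | rewrite <- le_plus_r]; reflexivity.
  - apply incl_app_inv in HX as (HX1 & HX2).
    destruct (IH1 _ HX1) as (A1 & B1 & C1), (IH2 c HX2) as (A2 & B2 & C2).
    split; [| split].
    + intros s Hs; rewrite seq_assoc, (A1 s Hs).
      apply reach_seq_lub; intros t Ht Hst.
      (* The guard places the atom of [t] in front of [g2], where the coverage of [g2] applies. *)
      rewrite (conn_guard X s t Ht), <- seq_assoc, (A2 t Ht).
      unfold reach; rewrite seq_sum; apply sum_lub; intros u Hu.
      apply in_select in Hu as (Hu & Htu).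
      rewrite (conn_seq X s t u Ht); apply conn_reach; [exact Hu |].
      exists t; split; assumption.
    + intros s t Hs (m & Hsm & Hmt) Htc; rewrite <- seq_assoc.
      apply (B1 s m Hs Hsm), (B2 m t); try assumption.
      exact (in_canonical X g1 s m Hs Hsm).
    + intros s t Hs (m & Hsm & Hmt); rewrite <- seq_assoc; intros Hle.
      apply (C2 m t (in_canonical X g1 s m Hs Hsm) Hmt).
      exact (C1 s m Hs Hsm Hle).
  - destruct (IH 1 HX) as (A & B & _).
    (* [closure] reduces only on a constructor; in every case [g * 1] is its head. *)
    assert (Hg : In (g * 1) X) by (apply HX; destruct g; left; reflexivity).
    apply test_facts; [exact H1 |]; intros s Hs.
    destruct (run_decides X g s A B H1 Hg Hs) as [(Hex & _ & E) | (Hn & _ & E)].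
    + split; [intros t (_ & Hn); contradiction | right; exact E].
    + split; [intros t (<- & _); auto | left; split; auto].
  - destruct (IH 1 HX) as (A & B & _).
    assert (Hg : In (g * 1) X) by (apply HX; destruct g; left; reflexivity).
    apply test_facts; [exact H1 |]; intros s Hs.
    destruct (run_decides X g s A B H1 Hg Hs) as [(Hex & E & _) | (Hn & E & _)].
    + split; [intros t (<- & _); auto | left; split; auto].
    + split; [intros t (_ & Hex); contradiction | right; exact E].
  - apply star_facts; [exact H1 | apply IH, HX].
Qed.

(** * Completeness for inclusions *)

Lemma completeness_le e f :
  (forall M : model Sigma Pi, inclusion _ (interp M e) (interp M f)) -> e ⊑ f.
Proof.
  intros Hincl.
  set (X := 1 :: closure e 1 ++ closure f 1).
  assert (H1 : In 1 X) by (left; reflexivity).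
  destruct (facts X e 1 H1) as (He & _).
  { apply incl_tl, incl_appl, incl_refl. }
  assert (HX : incl (closure f 1) X) by apply incl_tl, incl_appr, incl_refl.
  destruct (facts X f 1 H1 HX) as (_ & _ & Hf).
  assert (Hf1 : In (f * 1) X) by (apply HX; destruct f; left; reflexivity).
  rewrite <- (one_seq e), (one_le_atoms X), sum_seq.
  apply sum_lub; intros a Ha.
  destruct (classic (a ≡ 0)) as [-> | Hn]; [rewrite zero_seq; apply zero_le |].
  (* All residuals below [f] are taken: the sum stays below [f], and [f * 1] is among them. *)
  set (s := (a, select (fun x => x ⊑ f) X)).
  assert (Hs : In s (states X)).
  { apply in_states; split; [exact Ha | split; [apply select_sublist | exact Hn]]. }
  assert (Hsf : goal s ⊑ f).
  { apply sum_lub; intros x Hx; apply in_select in Hx; apply Hx. }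
  change a with (fst s); rewrite (He s Hs); apply reach_lub; intros t Ht Hi.
  (* It remains to bound the final atom by [goal t], since [conn s t * goal t] lies below [goal s]
     and hence below [f]. *)
  rewrite (conn_guard X s t Ht), <- Hsf, <- (conn_goal X s t).
  apply Seq_le; [reflexivity |].
  rewrite <- (seq_one (fst t)).
  (* The run of [e] is also a run of [f]; tracking the residual [f * 1] along it leaves [1] at
     [t]. *)
  apply (Hf s t Hs (Hincl (canonical X) s t Hi)).
  rewrite (test_seq_le (fst s) _ (state_test X s Hs)).
  apply (sum_ub (fun x => x)), in_select; split; [exact Hf1 |].
  apply equiv_le, seq_one.
Qed.

End Canonical.

(** * Soundness and the equivalence *)

Lemma clos_rt_mono {A : Type} (R S : relation A) :
  inclusion _ R S -> inclusion _ (clos_refl_trans _ R) (clos_refl_trans _ S).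
Proof.
  intros H x y Hxy; induction Hxy;
    [apply rt_step, H; assumption | apply rt_refl | eapply rt_trans; eassumption].
Qed.

(** Induction on the derivation, in pointwise form so that most rules become first-order
    tautologies. Excluded middle enters for [anti_compl] and [dom_anti]. *)
Lemma soundness {Sigma Pi : Type} (M : model Sigma Pi) (e f : expr Sigma Pi) :
  e ≡ f -> same_relation (carrier M) (interp M e) (interp M f).
Proof.
  intros H; enough (E : forall x y, interp M e x y <-> interp M f x y).
  { split; intros x y; apply E. }
  induction H; intros x y; simpl in *; unfold union in *.
  all: try (firstorder congruence; fail).
  - rewrite IHkad_equiv1; apply IHkad_equiv2.
  - setoid_rewrite IHkad_equiv1; setoid_rewrite IHkad_equiv2; reflexivity.
  - split; apply clos_rt_mono; intros u v; apply IHkad_equiv.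
  - split; [intros [[<- | (z & H1 & H2)] | H] | right; assumption].
    + apply rt_refl.
    + apply rt_trans with z; [apply rt_step |]; assumption.
    + exact H.
  - split; [intros [[<- | (z & H1 & H2)] | H] | right; assumption].
    + apply rt_refl.
    + apply rt_trans with z; [| apply rt_step]; assumption.
    + exact H.
  - split; [intros [(z & H1 & H2) | H'] | right; assumption]; [| exact H'].
    (* The run is unfolded on the side where the rule multiplies: at its first step here, at its
       last step for [star_ind_r]. *)
    apply clos_rt_rt1n in H1; induction H1 as [x | x u z Hxu _ IH];
      apply IHkad_equiv; left; [left | right]; eauto.
  - split; [intros [(z & H1 & H2) | H'] | right; assumption]; [| exact H'].
    apply clos_rt_rtn1 in H2; induction H2 as [| u y Huy _ IH];
      apply IHkad_equiv; left; [left | right]; eauto.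
  - split; [intros (z & (<- & Hn) & Hy); apply Hn; eauto | intros []].
  - enough (E : (exists z u, interp M e x u /\ interp M f u z) <->
                (exists z u, interp M e x u /\ u = z /\ exists v, interp M f u v))
      by (rewrite E; reflexivity).
    split; [intros (z & u & H1 & H2) | intros (z & u & H1 & _ & v & H2)]; eauto 7.
  - split; [tauto |].
    intros <-; destruct (classic (exists z, interp M e x z)); auto.
  - split; intros (<- & H); split; trivial.
    + intros (z & _ & Hn); contradiction.
    + apply NNPP; intros Hn; apply H; eauto.
Qed.

Theorem theorem4 (Sigma Pi : Type)
    (hSigma : countably_infinite Sigma) (hPi : countably_infinite Pi)
    (e f : expr Sigma Pi) :
  e ≡ f <->
  (forall M : model Sigma Pi,
     same_relation (carrier M) (interp M e) (interp M f)).
Proof.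
  split.
  - intros H M; exact (soundness M e f H).
  - intros H; apply le_antisym; apply completeness_le; intros M; apply H.
Qed.
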